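(* Let $\phi$ be an RDS whose phase space is a Banach space $H$ with norm $\|\cdot\|$. Suppose that this RDS is dissipative in $H$ with a forward invariant absorbing random set $B(\omega)$ such that the random variable $\rho(\omega)=\sup_{x\in B(\omega)}\|x\|$ is tempered and $\rho(\theta_t\omega)\in L^p_{loc}(\mathbb{R})$ (as a function of $t$) for some $p\ge1$ and all $\omega\in\Omega$. Assume that for each $\omega\in\Omega$ the RDS $\phi$ satisfies $$\|\phi(t,\omega,x_1)-\phi(t,\omega,x_2)\|\le M(\omega)\|x_1-x_2\|\quad\text{for all }t\in[0,1],\ x_1,x_2\in B(\omega),$$ and $$\|\phi(1,\omega,x_1)-\phi(1,\omega,x_2)\|\le{\cal N}(\phi(1,\omega,x_1)-\phi(1,\omega,x_2))+e^{\int_0^1r(\theta_\tau\omega)d\tau}\,\|x_1-x_2\|\quad\text{for all }x_1,x_2\in B(\omega).$$ Here $M(\omega)$ is a tempered and almost surely finite random variable, ${\cal N}(\cdot)$ is a positive (i.e. nonnegative-valued) continuous scalar function on $H$ such that ${\cal N}(x)\le C(1+\|x\|^p)$ for some constant $C$, and $r(\omega)$ is a random variable with finite expectation such that $\mathbb{E}r<0$. Then the condition $${\cal N}(\phi(n,\omega,x_1)-\phi(n,\omega,x_2))\to0\quad\text{in probability as }n\to+\infty$$ for some $x_1,x_2\in H$ implies that $$\|\phi(t,\omega,x_1)-\phi(t,\omega,x_2)\|\to0\quad\text{in probability as }t\to+\infty.$$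
   Context: Metric dynamical system: $(\Omega,{\cal F},\mathbb{P},\theta)$, where $(\Omega,{\cal F},\mathbb{P})$ is a probability space and $\theta:\mathbb{R}\times\Omega\to\Omega$ is a measurable flow ($\theta_0=\mathrm{id}$, $\theta_{t+\tau}=\theta_t\theta_\tau$), and $\mathbb{P}$ is ergodic with respect to $\theta$. A random dynamical system (RDS) over it with phase space $H$ (phase spaces are separable metric spaces) is a ${\cal B}(\mathbb{R}^+)\otimes{\cal F}\otimes{\cal B}(H),{\cal B}(H)$-measurable mapping $\phi:\mathbb{R}^+\times\Omega\times H\to H$ with the cocycle property $\phi(t+\tau,\omega,x)=\phi(t,\theta_\tau\omega,\phi(\tau,\omega,x))$, $\phi(0,\omega,x)=x$. Tempered: a random variable $x\ge0$ is tempered if $\lim_{t\to\pm\infty}\log^+x(\theta_t\omega)/|t|=0$ a.s. Dissipative in $H$: there is a compact random set $B\subset H$ which is forward invariant, $\phi(t,\omega,B(\omega))\subset B(\theta_t\omega)$ for $t>0$, and absorbing: for any $\varepsilon>0$ and any random variable $x(\omega)\in H$ there is $t_{\varepsilon,x}>0$ such that for $t\ge t_{\varepsilon,x}$ one has $\phi(t,\omega,x(\omega))\in B(\theta_t\omega)$ with probability (at least) $1-\varepsilon$. *)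

(* Defs.v *)
From HB Require Import structures.
From mathcomp Require Import all_boot all_order all_algebra.
From mathcomp Require Import all_classical all_reals all_analysis measurable_realfun.
Set Implicit Arguments.
Unset Strict Implicit.
Unset Printing Implicit Defensive.
Import Order.TTheory GRing.Theory Num.Theory.
Import numFieldNormedType.Exports.
Local Open Scope classical_set_scope.
Local Open Scope ring_scope.

Definition separable (X : topologicalType) : Prop :=
  exists2 S : set X, countable S & dense S.

Definition borelType (X : ptopologicalType) := g_sigma_algebraType (@open X).

Record metric_dynamical_system (R : realType) (d : measure_display)
    (T : measurableType d) (P : probability T R) (theta : R -> T -> T) : Prop := {
  mds_measurable : measurable_fun [set: R * T]
    (fun z : R * T => theta z.1 z.2);
  mds_0 : forall w, theta 0 w = w;
  mds_D : forall t tau w, theta (t + tau) w = theta t (theta tau w);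
  mds_invariant : forall t (A : set T), measurable A ->
    P (theta t @^-1` A) = P A;
  mds_ergodic : forall A : set T, measurable A ->
    (forall t, theta t @^-1` A = A) -> P A = 0%E \/ P A = 1%E }.

(* The values of phi at negative times are irrelevant: nothing below or in the
   theorem refers to them. *)
Record random_dynamical_system (R : realType) (d : measure_display)
    (T : measurableType d) (theta : R -> T -> T) (H : normedModType R)
    (phi : R -> T -> H -> H) : Prop := {
  rds_separable : separable H;
  rds_measurable : measurable_fun
    [set z : R * T * borelType H | 0 <= z.1.1]
    (fun z : R * T * borelType H =>
       phi z.1.1 z.1.2 z.2 : borelType H);
  rds_0 : forall w x, phi 0 w x = x;
  rds_D : forall (t tau : R) w x, 0 <= t -> 0 <= tau ->
    phi (t + tau) w x = phi t (theta tau w) (phi tau w x) }.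

(* edist_inf A x is the distance from x to A, equal to +oo when A is empty. *)
Definition compact_random_set (R : realType) (d : measure_display)
    (T : measurableType d) (H : normedModType R) (B : T -> set H) : Prop :=
  (forall w, compact (B w)) /\
  (forall x : H, measurable_fun [set: T]
     ((fun w => edist_inf (B w) x) : T -> \bar R)).

Definition forward_invariant (R : realType) (T : Type) (theta : R -> T -> T)
    (H : Type) (phi : R -> T -> H -> H) (B : T -> set H) : Prop :=
  forall (t : R) w, 0 < t -> phi t w @` B w `<=` B (theta t w).

Definition absorbing (R : realType) (d : measure_display)
    (T : measurableType d) (P : probability T R) (theta : R -> T -> T)
    (H : normedModType R) (phi : R -> T -> H -> H) (B : T -> set H) : Prop :=
  forall (eps : R) (x : T -> borelType H),
    0 < eps -> measurable_fun [set: T] x ->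
    exists2 t0 : R, 0 < t0 & forall t : R, t0 <= t ->
      ((1 - eps)%:E <= P [set w | B (theta t w) (phi t w (x w))])%E.

(* The RDS phi is dissipative, as witnessed by the random set B. *)
Record dissipative_with (R : realType) (d : measure_display)
    (T : measurableType d) (P : probability T R) (theta : R -> T -> T)
    (H : normedModType R) (phi : R -> T -> H -> H) (B : T -> set H) : Prop := {
  dissipative_set : compact_random_set B;
  dissipative_invariant : forward_invariant theta phi B;
  dissipative_absorbing : absorbing P theta phi B }.

Definition logp (R : realType) (x : \bar R) : \bar R := maxe 0%E (lne x).

Record tempered (R : realType) (d : measure_display)
    (T : measurableType d) (P : probability T R) (theta : R -> T -> T)
    (x : T -> \bar R) : Prop := {
  tempered_measurable : measurable_fun [set: T] x;
  tempered_ge0 : forall w, (0 <= x w)%E;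
  tempered_limit : {ae P, forall w,
    (logp (x (theta t w)) * (`|t|^-1)%:E)%E @[t --> +oo] --> 0%E /\
    (logp (x (theta t w)) * (`|t|^-1)%:E)%E @[t --> -oo] --> 0%E} }.

Definition Lp_loc (R : realType) (p : R) (f : R -> R) : Prop :=
  measurable_fun [set: R] f /\
  forall K : set R, compact K ->
    (\int[lebesgue_measure]_(t in K) (`|f t| `^ p)%:E < +oo)%E.

(* X i tends to 0 in probability along the filter F on the index set. *)
Definition cvg0_in_probability (R : realType) (d : measure_display)
    (T : measurableType d) (P : probability T R) (I : Type)
    (X : I -> T -> R) (F : set_system I) : Prop :=
  forall eps : R, 0 < eps ->
    P [set w | eps <= `|X i w|] @[i --> F] --> 0%E.

(* Main.v *)
Require Import Defs.
From HB Require Import structures.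
From mathcomp Require Import all_boot all_order all_algebra.
From mathcomp Require Import all_classical all_reals all_analysis measurable_realfun.
From mathcomp Require Import ring lra.
Set Implicit Arguments.
Unset Strict Implicit.
Unset Printing Implicit Defensive.
Import Order.TTheory GRing.Theory Num.Theory.
Import numFieldNormedType.Exports.
Local Open Scope classical_set_scope.
Local Open Scope ring_scope.

(* Write X_n for the distance of the two trajectories at time n and R for the mean
   of r along the flow over [0, 1]. Once both trajectories are in B,
     X_(n+1) <= N_(n+1) + exp(R(theta_n)) X_n,
   so for fixed L, X_(m+L) is at most a finite combination of N_(m+1), ..., N_(m+L)
   with stochastically bounded coefficients, plus
   exp(R(theta_m) + ... + R(theta_(m+L-1))) X_m. The combination tends to 0 in
   probability as m grows. In the last term X_m <= 2 rho(theta_m), and by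
   stationarity the exponential factor is small for L large, uniformly in m,
   provided that the ergodic sums of R tend to -oo in probability. Between integer
   times the factor M(theta_n) is stochastically bounded.

   For the ergodic sums, let E be the theta_1-invariant event that they are
   unbounded above. The maximal ergodic inequality gives E[R; E] >= 0. Ergodicity is
   assumed only for the flow and not for theta_1, so E need not be trivial; but by
   Fubini E[R; E] = E[r u], where u is the fraction of time in [0, 1] that the
   backward orbit spends in E. As u is invariant under the flow, it is almost surely
   the constant P(E), whence P(E) E[r] >= 0 and P(E) = 0. Replacing r by r + c with
   0 < c < -E[r] turns boundedness into divergence to -oo. *)

(** * The maximal ergodic inequality *)

Lemma indic_bounded (R : realType) (T : Type) (A D : set T) :
  [bounded (\1_A x : R^o) | x in D].
Proof.
exists 1; split => // r r1 x _ /=.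
rewrite indicE ger0_norm// (le_trans _ (ltW r1))//.
by case: (_ \in _).
Qed.

Lemma Rintegral_EFin (R : realType) (d : measure_display)
    (T : measurableType d) (mu : {measure set T -> \bar R}) (D : set T) (f : T -> R) :
  measurable D -> mu.-integrable D (EFin \o f) ->
  (\int[mu]_(w in D) f w)%:E = (\int[mu]_(w in D) (f w)%:E)%E.
Proof. by move=> mD fi; rewrite fineK//; exact: integrable_fin_num. Qed.

Lemma integrable_mul_indic (R : realType) (d : measure_display)
    (T : measurableType d) (mu : {measure set T -> \bar R}) (f : T -> R) (E : set T) :
  measurable E -> mu.-integrable [set: T] (EFin \o f) ->
  mu.-integrable [set: T] (EFin \o (fun w => f w * \1_E w)).
Proof.
move=> mE fi; apply: (integrableMl measurableT fi).
  exact: measurable_indic.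
exact: indic_bounded.
Qed.

Lemma measurable_gt_set (R : realType) (d : measure_display)
    (T : measurableType d) (f : T -> R) (a : R) :
  measurable_fun [set: T] f -> measurable [set w | a < f w].
Proof.
move=> mf; have -> : [set w | a < f w] = f @^-1` `]a, +oo[%classic.
  by apply/seteqP; split => w /=; rewrite in_itv /= andbT.
by rewrite -[X in measurable X]setTI; apply: mf => //; exact: measurable_itv.
Qed.

Section measure_preserving.
Context (R : realType) (d : measure_display) (T : measurableType d)
  (P : probability T R) (U : T -> T).
Hypothesis mU : measurable_fun [set: T] U.
Hypothesis pU : forall A, measurable A -> P (U @^-1` A) = P A.

Lemma mp_integrable (g : T -> \bar R) : P.-integrable [set: T] g ->
  P.-integrable [set: T] (g \o U).
Proof.
move=> /integrableP[mg ig]; apply/integrableP; split.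
  exact: measurableT_comp.
apply: le_lt_trans ig.
rewrite [leRHS](eq_measure_integral (pushforward P U)); last first.
  by move=> A mA _; symmetry; exact: pU.
rewrite (@ge0_integral_pushforward _ _ _ _ _ _ mU P setT (fun x => `|g x|%E))//.
by apply: measurableT_comp.
Qed.

Lemma mp_integral (g : T -> \bar R) : P.-integrable [set: T] g ->
  (\int[P]_w (g (U w)) = \int[P]_w (g w))%E.
Proof.
move=> ig; have [mg _] := integrableP _ _ _ ig.
rewrite [RHS](eq_measure_integral (pushforward P U)); last first.
  by move=> A mA _; symmetry; exact: pU.
by rewrite integral_pushforward//; exact: mp_integrable.
Qed.

Variable f : T -> R.
Hypothesis intf : P.-integrable [set: T] (EFin \o f).

(** This is the maximum of the partial sums of [f] along the orbit over the lengths 0 to [n].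
    Splitting off the first term rather than the last brings in [U], ready for the use of
    invariance. *)
Fixpoint ergodic_max n (w : T) : R :=
  if n is n'.+1 then Num.max 0 (f w + ergodic_max n' (U w)) else 0.

Lemma ergodic_max_ge0 n w : 0 <= ergodic_max n w.
Proof. by case: n => [|n] //=; rewrite le_max lexx. Qed.

Lemma ergodic_max_nd n w : ergodic_max n w <= ergodic_max n.+1 w.
Proof.
elim: n w => [|n IH] w; first exact: ergodic_max_ge0.
rewrite [leLHS]/= [leRHS]/= ge_max le_max lexx /=.
by rewrite le_max lerD2l IH orbT.
Qed.

Lemma sum_le_ergodic_max n w :
  \sum_(j < n) f (iter j U w) <= ergodic_max n w.
Proof.
elim: n w => [|n IH] w; first by rewrite big_ord0.
rewrite big_ord_recl /= le_max; apply/orP; right; rewrite lerD2l.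
by apply: le_trans (IH (U w)); under eq_bigr do rewrite -iterS iterSr.
Qed.

Lemma ergodic_max_integrable n : P.-integrable [set: T] (EFin \o ergodic_max n).
Proof.
elim: n => [|n IH] /=.
  by apply: (eq_integrable measurableT (cst 0%E)) => //; exact: integrable0.
have iD : P.-integrable [set: T] (fun w => (f w)%:E + (ergodic_max n (U w))%:E)%E.
  apply: integrableD => //; exact: (mp_integrable IH).
apply: (le_integrable measurableT _ _ iD).
- apply/measurable_EFinP; apply: measurable_maxr => //.
  apply: measurable_funD; first exact/measurable_EFinP/(measurable_int P).
  have := measurable_int P (mp_integrable IH).
  by move/measurable_EFinP.
- move=> w _; rewrite -EFinD /= lee_fin ger0_norm ?le_max ?lexx//.
  by rewrite ge_max normr_ge0 ler_norm.
Qed.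

(* Garsia's argument: where [ergodic_max n.+1] is positive, it equals
   [f + ergodic_max n \o U], so there [f >= ergodic_max n.+1 - ergodic_max n.+1 \o U]. *)
Lemma ergodic_max_integral_ge0 n :
  0 <= \int[P]_w (f w * \1_[set w | 0 < ergodic_max n w] w).
Proof.
case: n => [|n].
  rewrite (_ : [set _ | _] = set0).
    by apply: Rintegral_ge0 => w _; rewrite indic0 mulr0.
  by apply/seteqP; split => w //=; rewrite ltxx.
set M := ergodic_max n.+1.
have iM := ergodic_max_integrable n.+1.
have mM : measurable_fun [set: T] M.
  by have /integrableP[/measurable_EFinP] := iM.
have iMU : P.-integrable [set: T] (EFin \o (M \o U)) by exact: (mp_integrable iM).
have iM0 : \int[P]_w (M w - M (U w)) = 0.
  rewrite RintegralB// /Rintegral.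
  by rewrite (mp_integral iM) subrr.
have mE : measurable [set w | 0 < M w].
  exact: measurable_gt_set.
rewrite -[leLHS]iM0; apply: le_Rintegral => //.
- exact: (integrableB measurableT iM iMU).
- apply: (integrableMl measurableT intf); first exact: measurable_indic.
  exact: indic_bounded.
- move=> w _; rewrite indicE.
  case: (boolP (w \in _)); rewrite ?notin_setE ?in_setE /= => Mw.
    rewrite mulr1 lerBlDr; apply: le_trans (_ : f w + ergodic_max n (U w) <= _).
      by move: Mw; rewrite /M /= lt_max ltxx /= => /ltW /max_idPr ->.
    by rewrite lerD2l ergodic_max_nd.
  (* Off the set, [M w] is at most 0 while [M (U w)] is nonnegative. *)
  rewrite mulr0 subr_le0; apply: le_trans (ergodic_max_ge0 _ _).
  by rewrite leNgt; apply/negP.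
Qed.

End measure_preserving.

Section invariant_sets.
Context (R : realType) (d : measure_display) (T : measurableType d)
  (P : probability T R) (U : T -> T).
Hypothesis mU : measurable_fun [set: T] U.
Hypothesis pU : forall A, measurable A -> P (U @^-1` A) = P A.

(** The maximal inequality is applied to [h], the product of [f] and [\1_E]. Orbits from [E] stay in
    [E], so there the sums of [h] are those of [f] and each point eventually lies in [A n]; off [E],
    [h] is 0. Dominated convergence removes the restriction to [A n]. *)
Lemma invariant_integral_ge0 (f : T -> R) (E : set T) :
  P.-integrable [set: T] (EFin \o f) -> measurable E ->
  U @^-1` E = E ->
  (forall w, E w -> exists n, 0 < \sum_(j < n) f (iter j U w)) ->
  0 <= \int[P]_w (f w * \1_E w).
Proof.
move=> fi mE UE posE; pose h w := f w * \1_E w.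
have hi : P.-integrable [set: T] (EFin \o h) by exact: integrable_mul_indic.
pose A n := [set w | 0 < ergodic_max U h n w].
have mA n : measurable (A n).
  apply: measurable_gt_set.
  by have /integrableP[/measurable_EFinP] := ergodic_max_integrable mU pU hi n.
have hAi n := integrable_mul_indic (mA n) hi.
have itE j w : E w -> E (iter j U w).
  elim: j => //= j IH /IH; rewrite -{1}UE; exact.
have ndA w m n : (m <= n)%N -> ergodic_max U h m w <= ergodic_max U h n w.
  by move: m n; apply/nondecreasing_seqP => k; exact: ergodic_max_nd.
have [||_ _] := @dominated_convergence _ _ _ P setT measurableT
  (fun n w => (h w * \1_(A n) w)%:E) (fun w => (h w)%:E) (fun w => `|h w|%:E)
  (fun n => measurable_int _ (hAi n)) (measurable_int _ hi) _ (integrable_abse hi) _.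
- apply: aeW => w _.
  case: (pselect (E w)) => [Ew|nEw]; last first.
    rewrite /h indicE memNset// mulr0.
    by under eq_fun do rewrite mul0r; exact: cvg_cst.
  have [n0 n0pos] := posE _ Ew.
  apply: cvg_near_cst; exists n0 => // n /= n0n.
  rewrite [\1_(A n) w]indicE mem_set ?mulr1//.
  apply: lt_le_trans (ndA w _ _ n0n).
  apply: lt_le_trans (sum_le_ergodic_max _ _ _ _).
  rewrite (eq_bigr (fun j : 'I_n0 => f (iter j U w)))// => j _.
  by rewrite /h indicE mem_set ?mulr1//; exact: itE.
- apply: aeW => w n _; rewrite /= lee_fin normrM ler_piMr//.
  by rewrite indicE ger0_norm//; case: (_ \in _).
move=> cv; rewrite -lee_fin Rintegral_EFin//.
apply: (cvge_ge _ cv).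
by apply: nearW => n /=; rewrite -Rintegral_EFin// lee_fin; exact: ergodic_max_integral_ge0.
Qed.
End invariant_sets.

(** * Invariant functions and occupation times *)

Section translation.
Context (R : realType).
Local Notation mu := (@lebesgue_measure R).

Lemma lebesgue_measure_translation (A : set R) (t : R) : measurable A ->
  mu [set x | A (x + t)] = mu A.
Proof.
move=> mA.
pose shift_t : measurableTypeR R -> measurableTypeR R := +%R^~ t.
have mt : measurable_fun [set: measurableTypeR R] shift_t.
  exact: measurable_funD.
apply/esym.
apply: (@lebesgue_measure_unique _ (pushforward mu shift_t)) => //=.
move=> _ [[a b] _ <-]; rewrite /pushforward.
have -> : shift_t @^-1` `]a, b]%classic = `]a - t, b - t]%classic.
  by apply/seteqP; split => x /=; rewrite !in_itv /= ltrBlDr lerBrDr.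
rewrite !lebesgue_measure_itv /= !lte_fin ltrD2r.
by case: ifP => // _; rewrite -!EFinB; congr (_%:E); ring.
Qed.

(** Translation turns the left side into the measure of [D] in [[t, 1 + t[]. This interval is cut at
    1, and its second piece moves back by one period onto [[0, t[]. *)
Lemma lebesgue_measure_periodic (D : set R) (t : R) : measurable D ->
  (forall s, D (s + 1) <-> D s) -> 0 <= t <= 1 ->
  mu (`[0, 1[ `&` [set s | D (s + t)]) = mu (`[0, 1[ `&` D).
Proof.
move=> mD D1 /andP[t0 t1].
have mI (a b : R) : measurable (`[a, b[ `&` D) by exact: measurableI.
have split_ (a b c : R) : a <= b -> b <= c ->
    mu (`[a, c[ `&` D) = (mu (`[a, b[ `&` D) + mu (`[b, c[ `&` D))%E.
  move=> ab bc; rewrite -measureU//.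
    rewrite -setIUl; congr (mu (_ `&` _)).
    apply/seteqP; split => x /=; rewrite !in_itv /=.
      by move=> /andP[-> ->]; case: (ltrP x b); [left|right].
    move=> [|] /andP[h1 h2]; rewrite ?h1 ?h2 ?andbT /=.
      exact: lt_le_trans bc.
    exact: le_trans h1.
  1,2: exact: mI.
  apply/seteqP; split => // x /= []; rewrite !in_itv /=.
  by move=> [/andP[_ xb]] _ [/andP[bx _] _]; move: (lt_le_trans xb bx); rewrite ltxx.
have -> : `[0, 1[ `&` [set s | D (s + t)] =
    [set s | (`[t, 1 + t[ `&` D) (s + t)].
  by apply/seteqP; split => x /=; rewrite !in_itv /= lerDr ltrD2r.
rewrite (lebesgue_measure_translation t (mI _ _)).
rewrite (split_ t 1)// ?lerDl// addeC (split_ 0 t 1)//; congr (_ + _)%E.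
rewrite -(lebesgue_measure_translation 1 (mI 1 (1 + t))).
congr (mu _); apply/seteqP; split => x /=; rewrite !in_itv /= lerDr;
  rewrite [1 + t]addrC ltrD2r => -[-> h]; split=> //; exact/D1.
Qed.
End translation.

Section ae.
Context (R : realType) (d : measure_display) (T : measurableType d) (P : probability T R).
Lemma ae_prob1 (A : set T) : measurable A -> P A = 1%E -> {ae P, forall w, A w}.
Proof.
move=> mA A1; exists (~` A); split => //; first exact: measurableC.
by rewrite probability_setC// A1 subee.
Qed.

Lemma ae_prob0 (A : set T) : measurable A -> P A = 0%E -> {ae P, forall w, ~ A w}.
Proof.
by move=> mA A0; exists A; split => // w /= /contrapT.
Qed.

Lemma ae_ge0_Rintegral_eq0 (g : T -> R) : P.-integrable [set: T] (EFin \o g) ->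
  {ae P, forall w, 0 <= g w} -> \int[P]_w g w = 0 -> {ae P, forall w, g w = 0}.
Proof.
move=> ig g0 I0; have /integrableP[mg _] := ig.
have : (\int[P]_w `|(EFin \o g) w|%E = 0)%E.
  rewrite -[RHS]/(0%:E) -I0 Rintegral_EFin//.
  apply: ae_eq_integral => //; first exact: measurableT_comp.
  by apply: filterS g0 => w gw _ /=; rewrite ger0_norm.
move/(ae_eq_integral_abs P measurableT mg); apply: filterS => w /(_ I) /=.
by move=> [].
Qed.
End ae.

Section flow.
Context (R : realType) (d : measure_display) (T : measurableType d)
  (P : probability T R) (theta : R -> T -> T).
Hypothesis mds : metric_dynamical_system P theta.

Lemma flow_measurable t : measurable_fun [set: T] (theta t).
Proof.
apply: (measurableT_comp (mds_measurable mds) (_ : measurable_fun _ (fun w => (t, w)))).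
exact: measurable_fun_pair.
Qed.

(** The events that [u] lies below or above its mean are invariant, hence of probability 0 or 1. If
    one has probability 1, a nonnegative function with integral 0 vanishes almost surely, so [u] is
    its mean in every case. *)
Lemma invariant_ae_cst (u : T -> R) : P.-integrable [set: T] (EFin \o u) ->
  (forall t w, u (theta t w) = u w) -> {ae P, forall w, u w = \int[P]_w u w}.
Proof.
move=> ui uE; set k := \int[P]_w u w.
have /integrableP[/measurable_EFinP mu _] := ui.
have ik : P.-integrable [set: T] (EFin \o (fun=> k)) by exact: finite_measure_integrable_cst.
have Ik : \int[P]_w k = k.
  rewrite Rintegral_cst// -[RHS]mulr1; congr (_ * _).
  exact: (congr1 fine (probability_setT P)).
have mlt : measurable [set w | 0 < k - u w].
  by apply: measurable_gt_set; exact: measurable_funB.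
have mgt : measurable [set w | k < u w] by exact: measurable_gt_set.
have lt_inv t : theta t @^-1` [set w | 0 < k - u w] = [set w | 0 < k - u w].
  by apply/seteqP; split => w /=; rewrite uE.
have gt_inv t : theta t @^-1` [set w | k < u w] = [set w | k < u w].
  by apply/seteqP; split => w /=; rewrite uE.
have [lt0|lt1] := mds_ergodic mds mlt lt_inv; last first.
  suff : {ae P, forall w, k - u w = 0}.
    by apply: filterS => w /eqP; rewrite subr_eq0 => /eqP ->.
  apply: ae_ge0_Rintegral_eq0; first exact: (integrableB measurableT ik ui).
    by apply: filterS (ae_prob1 mlt lt1) => w /= /ltW.
  by rewrite RintegralB// Ik subrr.
have [gt0|gt1] := mds_ergodic mds mgt gt_inv; last first.
  suff : {ae P, forall w, u w - k = 0}.
    by apply: filterS => w /eqP; rewrite subr_eq0 => /eqP ->.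
  apply: ae_ge0_Rintegral_eq0; first exact: (integrableB measurableT ui ik).
    by apply: filterS (ae_prob1 mgt gt1) => w /= /ltW; rewrite subr_ge0.
  by rewrite RintegralB// Ik subrr.
apply: filterS2 (ae_prob0 mlt lt0) (ae_prob0 mgt gt0) => w /= h1 h2.
apply/eqP; rewrite eq_le; apply/andP.
by split; rewrite leNgt; apply/negP => //; rewrite -subr_gt0.
Qed.

(** The interval is half-open so that its integer translates tile the line. It enters as a factor of
    the integrand so that Fubini applies on the whole product. *)
Definition occupation (E : set T) (w : T) : R :=
  \int[lebesgue_measure]_s (\1_E (theta (- s) w) * \1_(`[0, 1[ : set R) s).

Lemma orbit_measurable w : measurable_fun [set: R] (fun s => theta s w).
Proof.
apply: (measurableT_comp (mds_measurable mds) (_ : measurable_fun _ (fun s => (s, w)))).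
exact: measurable_fun_pair.
Qed.

Lemma backward_orbit_measurable w (E : set T) : measurable E ->
  measurable [set s : R | E (theta (- s) w)].
Proof.
move=> mE; have mo : measurable_fun [set: R] (fun s => theta (- s) w).
  by apply: (measurableT_comp (orbit_measurable w)); exact: oppr_measurable.
by rewrite -[X in measurable X]setTI; exact: mo.
Qed.

Lemma occupationE E w : measurable E ->
  occupation E w = fine (lebesgue_measure (`[0, 1[ `&` [set s : R | E (theta (- s) w)])).
Proof.
move=> mE; rewrite /occupation /Rintegral -[X in lebesgue_measure X]setIT -integral_indic//.
  congr fine; apply: eq_integral => s _; rewrite !indicE in_setI mulrC.
  by rewrite -mulnb natrM.
apply: measurableI => //.
exact: backward_orbit_measurable.
Qed.

(** The times at which the backward orbit is in [E] form a set of period 1, and moving [w] back by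
    [t] translates this set by [t]. *)
Lemma occupation_invariant (E : set T) : measurable E -> theta 1 @^-1` E = E ->
  forall t w, occupation E (theta t w) = occupation E w.
Proof.
move=> mE E1.
have E1P w : E (theta 1 w) <-> E w by rewrite -{2}E1.
have small t w : 0 <= t <= 1 -> occupation E (theta (- t) w) = occupation E w.
  move=> t01; rewrite !occupationE//.
  rewrite -(@lebesgue_measure_periodic _ [set s | E (theta (- s) w)] t)//.
  - congr (fine (lebesgue_measure _)).
    by apply/seteqP; split => s /=; rewrite -(mds_D mds) opprD.
  - exact: backward_orbit_measurable.
  - move=> s; rewrite /= -[X in _ <-> X]E1P /= -E1P -!(mds_D mds).
    by rewrite opprD addrCA subrr addr0 -E1P -(mds_D mds).
have itert n t w : 0 <= t <= 1 -> occupation E (theta (- (t *+ n)) w) = occupation E w.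
  move=> t01; elim: n w => [|n IH] w; first by rewrite oppr0 (mds_0 mds).
  by rewrite mulrS opprD (mds_D mds) small.
have neg t w : 0 <= t -> occupation E (theta (- t) w) = occupation E w.
  (* As [n] exceeds [t], the time [t] splits into [n] steps of length [t / n], each in [[0, 1]]. *)
  move=> t0; pose n := (Num.trunc t).+1.
  have n0 : 0 < n%:R :> R by rewrite ltr0n.
  rewrite (_ : - t = - ((t / n%:R) *+ n)); last first.
    by rewrite -[in RHS]mulr_natr divfK// lt0r_neq0.
  rewrite itert//.
  by rewrite divr_ge0// ler_pdivrMr// mul1r ltW// truncnS_gt.
move=> t w; case: (lerP 0 t) => t0; last by rewrite -[t]opprK neg// oppr_ge0 ltW.
by rewrite -(neg t (theta t w))// -(mds_D mds) addNr (mds_0 mds).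
Qed.
End flow.

(** * Time averages over unit intervals *)

Section unit_time_mean.
Context (R : realType) (d : measure_display) (T : measurableType d)
  (P : probability T R) (theta : R -> T -> T).
Hypothesis mds : metric_dynamical_system P theta.
Variable r : T -> R.
Hypothesis ri : P.-integrable [set: T] (EFin \o r).
Local Notation mu := (@lebesgue_measure R).
Local Notation A := (`[0, 1[%classic : set R).

Lemma integral_unit : (\int[mu]_s (\1_A s)%:E = 1)%E.
Proof.
rewrite integral_indic ?setIT//.
by apply: eq_trans (lebesgue_measure_itv _) _; rewrite /= lte_fin ltr01 oppr0 adde0.
Qed.

(** By Tonelli with [P] integrated first, a bound on the [L^1(P)] norms uniform in [s] suffices,
    since the time interval has length 1. *)
Lemma integrable_prod_unit (h : T -> R -> R) (K : R) :
  measurable_fun [set: T * R] (fun z => h z.1 z.2) ->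
  (forall s, (\int[P]_w `|h w s|%:E <= K%:E)%E) ->
  (P \x mu)%E.-integrable [set: T * R] (fun z => (h z.1 z.2 * \1_A z.2)%:E).
Proof.
move=> mh hK.
have mg : measurable_fun [set: T * R] (fun z => (h z.1 z.2 * \1_A z.2)%:E).
  apply/measurable_EFinP; apply: measurable_funM => //.
  by apply: (measurableT_comp (measurable_indic _)).
apply/(integrable21ltyP P mu mg).
apply: (@le_lt_trans _ _ (\int[mu]_s (K%:E * (\1_A s)%:E))%E); last first.
  rewrite ge0_integralZl//=; last 2 first.
  - by apply/measurable_EFinP; exact: measurable_indic.
  - by rewrite (le_trans _ (hK 0))// integral_ge0.
  - by rewrite integral_unit mule1 ltry.
have mG : measurable_fun [set: R]
    (fubini_G P (fun z => `|h z.1 z.2 * \1_A z.2|%:E)).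
  apply: measurable_fun_fubini_tonelli_G => //.
  apply/measurable_EFinP; apply: measurableT_comp => //.
  by apply/measurable_EFinP.
apply: ge0_le_integral => //.
- by move=> s _; exact: integral_ge0.
- by apply/measurable_EFinP; apply: measurable_funM => //; exact: measurable_indic.
move=> s _; rewrite indicE; case: (s \in A) => /=.
  rewrite mule1; apply: le_trans (hK s); rewrite le_eqVlt; apply/orP; left; apply/eqP.
  by apply: eq_integral => w _; rewrite mulr1.
rewrite mule0; under eq_integral do rewrite mulr0 normr0.
by rewrite integral0.
Qed.

(** Where [r] is not integrable along the orbit, the value is the default 0. Identities that need
    the true integral therefore hold only almost surely. *)
Definition time_one_mean (w : T) : R := \int[mu]_(s in `[0, 1]) r (theta s w).

Let mr : measurable_fun [set: T] r.
Proof. by have /integrableP[/measurable_EFinP] := ri. Qed.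

Let K : R := fine (\int[P]_w `|r w|%:E).
Let KE : (K%:E = \int[P]_w `|r w|%:E)%E.
Proof. by rewrite fineK//; have := integrable_fin_num measurableT (integrable_abse ri). Qed.

Let mflow : measurable_fun [set: T * R] (fun z => theta z.2 z.1).
Proof.
apply: (measurableT_comp (mds_measurable mds) (_ : measurable_fun _ (fun z => (z.2, z.1)))).
exact: measurable_fun_pair.
Qed.

Let mbackflow : measurable_fun [set: T * R] (fun z => theta (- z.2) z.1).
Proof.
have mN : measurable_fun [set: T * R] (fun z : T * R => (- z.2, z.1)).
  by apply: measurable_fun_pair => //; exact: measurableT_comp.
exact: (measurableT_comp (mds_measurable mds) mN).
Qed.

(** Invariance gives [r] composed with [theta s] the [L^1] norm of [r], for every [s]. This
    integrand and that of [integrable_backward] are exchanged by substituting [theta s w] for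
    [w]. *)
Lemma integrable_forward (E : set T) : measurable E ->
  (P \x mu)%E.-integrable [set: T * R]
    (fun z => (r (theta z.2 z.1) * \1_E z.1 * \1_A z.2)%:E).
Proof.
move=> mE; apply: (@integrable_prod_unit (fun w s => r (theta s w) * \1_E w) K).
  apply: measurable_funM; first exact: measurableT_comp.
  by apply: (measurableT_comp (measurable_indic _)).
move=> s; rewrite KE.
rewrite -(mp_integral (flow_measurable mds s) (mds_invariant mds s)
  (integrable_abse ri)).
apply: ge0_le_integral => //.
- apply/measurable_EFinP; apply: measurableT_comp => //; apply: measurable_funM.
    by apply: (measurableT_comp mr); exact: (flow_measurable mds).
  exact: measurable_indic.
- apply/measurable_EFinP; apply: measurableT_comp => //.
  by apply: (measurableT_comp mr); exact: (flow_measurable mds).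
- move=> w _; rewrite lee_fin normrM ler_piMr// indicE ger0_norm//.
  by case: (_ \in _).
Qed.

Lemma integrable_backward (E : set T) : measurable E ->
  (P \x mu)%E.-integrable [set: T * R]
    (fun z => (r z.1 * \1_E (theta (- z.2) z.1) * \1_A z.2)%:E).
Proof.
move=> mE; apply: (@integrable_prod_unit (fun w s => r w * \1_E (theta (- s) w)) K).
  apply: measurable_funM; first exact: measurableT_comp.
  by apply: (measurableT_comp (measurable_indic _)).
move=> s; rewrite KE.
apply: ge0_le_integral => //.
- apply/measurable_EFinP; apply: measurableT_comp => //; apply: measurable_funM => //.
  by apply: (measurableT_comp (measurable_indic _)) => //; exact: (flow_measurable mds).
- by apply/measurable_EFinP; apply: measurableT_comp.
- move=> w _; rewrite lee_fin normrM ler_piMr// indicE ger0_norm//.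
  by case: (_ \in _).
Qed.

(** The factor [\1_[set: T] w] is 1; it gives the integrand the form of [integrable_forward] for the
    full set. *)
Lemma time_one_meanE w :
  time_one_mean w = fine (\int[mu]_s (r (theta s w) * \1_[set: T] w * \1_A s)%:E).
Proof.
rewrite /time_one_mean /Rintegral -integral_itv_bndo_bndc; last first.
  apply/measurable_EFinP; apply: measurable_funTS; apply: (measurableT_comp mr).
  exact: (orbit_measurable mds).
rewrite integral_mkcond; congr fine; apply: eq_integral => s _.
rewrite /patch !indicE in_setT mulr1.
by case: ifP; rewrite ?mulr1 ?mulr0.
Qed.

Lemma orbit_integrable : {ae P, forall w,
  mu.-integrable `[0, 1] (fun s => (r (theta s w))%:E)}.
Proof.
have := ae_integrable1 (integrable_forward measurableT).
apply: filterS => w /= iw.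
have mo : measurable_fun [set: R] (fun s => (r (theta s w))%:E).
  apply/measurable_EFinP; apply: (measurableT_comp mr).
  exact: (orbit_measurable mds).
apply/integrableP; split; first exact: measurable_funTS.
have /integrableP[_] := iw; apply: le_lt_trans.
rewrite -integral_itv_bndo_bndc; last first.
  by apply: measurable_funTS; exact: measurableT_comp.
rewrite integral_mkcond le_eqVlt; apply/orP; left; apply/eqP.
apply: eq_integral => s _; rewrite /patch !indicE in_setT mulr1.
by case: ifP; rewrite ?mulr1 ?mulr0 ?abse0.
Qed.

Lemma time_one_mean_integrable : P.-integrable [set: T] (EFin \o time_one_mean).
Proof.
have iF := integrable_fubini_F (integrable_forward measurableT).
have /integrableP[mF _] := iF.
apply: (le_integrable measurableT _ _ iF).
  apply/measurable_EFinP; rewrite (funext time_one_meanE).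
  exact: measurableT_comp.
move=> w _; rewrite /= time_one_meanE /fubini_F /=.
(* Sending infinite values to 0 does not increase the absolute value. *)
by case: (\int[mu]_y _)%E => [x||] //=; rewrite normr0 leey.
Qed.

Lemma occupation_integrable (E : set T) w : measurable E ->
  mu.-integrable [set: R]
    (EFin \o (fun s => \1_E (theta (- s) w) * \1_A s)).
Proof.
move=> mE; have iA : mu.-integrable [set: R] (fun s => (\1_A s)%:E).
  apply/integrableP; split; first by apply/measurable_EFinP; exact: measurable_indic.
  under eq_integral do rewrite gee0_abs ?lee_fin//.
  by rewrite integral_unit ltry.
apply: le_integrable iA => //.
  apply/measurable_EFinP; apply: measurable_funM; last exact: measurable_indic.
  exact: (measurable_indic (backward_orbit_measurable mds w mE)).
move=> s _; rewrite lee_fin normrM ler_piMl// indicE ger0_norm//.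
by case: (_ \in _).
Qed.

(** The order of integration is exchanged, [theta s] preserves [P] for each fixed [s], and the order
    is exchanged back: the motion passes from [r] to [E]. *)
Lemma integral_time_one_mean (E : set T) : measurable E ->
  \int[P]_w (time_one_mean w * \1_E w) = \int[P]_w (r w * occupation theta E w).
Proof.
move=> mE; rewrite /Rintegral; congr fine.
have iF := integrable_forward mE; have iB := integrable_backward mE.
transitivity (\int[P]_w \int[mu]_s (r (theta s w) * \1_E w * \1_A s)%:E)%E.
  (* The real-valued mean agrees with the extended integral only where the latter is finite, which
     is almost everywhere. *)
  apply: ae_eq_integral => //.
  - by have /integrableP[] := integrable_mul_indic mE time_one_mean_integrable.
  - by have /integrableP[] := integrable_fubini_F iF.
  have := ae_integrable1 (integrable_forward measurableT).
  apply: filterS => w /= iw _; rewrite time_one_meanE.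
  move: iw; rewrite !indicE in_setT; case: (w \in E) => iw.
    by rewrite mulr1; apply: fineK; exact: (integrable_fin_num measurableT iw).
  rewrite mulr0; under eq_integral do rewrite mulr0 mul0r.
  by rewrite integral0.
rewrite (Fubini iF).
transitivity (\int[mu]_s \int[P]_w (r w * \1_E (theta (- s) w) * \1_A s)%:E)%E.
  apply: eq_integral => s _.
  rewrite -[RHS](mp_integral (flow_measurable mds s) (mds_invariant mds s)).
    by apply: eq_integral => w _; rewrite -(mds_D mds) addNr (mds_0 mds).
  apply: (le_integrable measurableT _ _ ri).
    apply/measurable_EFinP; apply: measurable_funM => //; apply: measurable_funM => //.
    by apply: (measurableT_comp (measurable_indic _)) => //; exact: (flow_measurable mds).
  move=> w _; rewrite lee_fin !normrM -mulrA ler_piMr// mulr_ile1//.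
    by rewrite indicE ger0_norm//; case: (_ \in _).
  by rewrite indicE ger0_norm//; case: (_ \in _).
rewrite -(Fubini iB); apply: eq_integral => w _.
rewrite EFinM /occupation Rintegral_EFin//; last exact: occupation_integrable.
rewrite -(integralZl measurableT (occupation_integrable w mE)).
by apply: eq_integral => s _; rewrite -mulrA.
Qed.
End unit_time_mean.

(** * Divergence of the ergodic sums to minus infinity *)

Lemma prob_cvg0_of_ae_eventually (R : realType) (d : measure_display)
    (T : measurableType d) (P : probability T R) (A : nat -> set T) :
  (forall n, measurable (A n)) ->
  {ae P, forall w, \forall n \near \oo, ~ A n w} ->
  P (A n) @[n --> \oo] --> 0%E.
Proof.
move=> mA evA.
have [||_ _] := @dominated_convergence _ _ _ P setT measurableT
  (fun n w => (\1_(A n) w)%:E) (cst 0%E) (cst 1%E)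
  (fun n => measurable_int _ (integrable_indic P (mA n))) (measurable_cst _) _
  (finite_measure_integrable_cst P 1 measurableT) _.
- apply: filterS evA => w ev _; apply: cvg_near_cst.
  by apply: filterS ev => n nA; rewrite indicE memNset.
- apply: aeW => w n _; rewrite /= lee_fin indicE ger0_norm//.
  by case: (_ \in _).
rewrite integral0; under eq_fun do rewrite integral_indic// setIT; exact.
Qed.

Section ergodic_sums.
Context (R : realType) (d : measure_display) (T : measurableType d)
  (P : probability T R) (theta : R -> T -> T).
Hypothesis mds : metric_dynamical_system P theta.

Lemma ae_flow (Q : T -> Prop) : {ae P, forall w, Q w} ->
  forall t, {ae P, forall w, Q (theta t w)}.
Proof.
move=> [A [mA A0 QA]] t; exists (theta t @^-1` A); split.
- by rewrite -[X in measurable X]setTI; exact: (flow_measurable mds).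
- by rewrite (mds_invariant mds).
- by move=> w /= nQ; exact: QA.
Qed.

Lemma orbit_integrable_nat (r : T -> R) : P.-integrable [set: T] (EFin \o r) ->
  {ae P, forall w, forall j : nat, lebesgue_measure.-integrable `[0, 1]
    (fun s => (r (theta s (theta j%:R w)))%:E)}.
Proof.
move=> ri; apply: ae_foralln => j; exact: (ae_flow (orbit_integrable mds ri)).
Qed.

Lemma iter_flow n w : iter n (theta 1) w = theta n%:R w.
Proof.
elim: n w => [|n IH] w; first by rewrite (mds_0 mds).
by rewrite iterS IH -(mds_D mds) -natr1 addrC.
Qed.

Lemma sum_flow_bounded (r : T -> R) : P.-integrable [set: T] (EFin \o r) ->
  \int[P]_w r w < 0 ->
  {ae P, forall w, exists K : R, forall n,
    \sum_(j < n) time_one_mean theta r (theta j%:R w) <= K}.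
Proof.
move=> ri r0.
pose f := time_one_mean theta r.
have fi : P.-integrable [set: T] (EFin \o f) := time_one_mean_integrable mds ri.
have mf : measurable_fun [set: T] f by have /integrableP[/measurable_EFinP] := fi.
pose S n w := \sum_(j < n) f (theta j%:R w).
have mS n : measurable_fun [set: T] (S n).
  apply: measurable_sum => j; apply: (measurableT_comp mf); exact: (flow_measurable mds).
have SS n w : S n.+1 w = f w + S n (theta 1 w).
  rewrite /S big_ord_recl (mds_0 mds); congr (_ + _); apply: eq_bigr => j _.
  by rewrite -(mds_D mds) -natr1.
(* Natural thresholds make [E] a countable intersection of countable unions. *)
pose E := [set w | forall K : nat, exists n, K%:R < S n w].
have mE : measurable E.
  have -> : E = \bigcap_(K : nat) \bigcup_n [set w | K%:R < S n w].
    apply/seteqP; split => w /= h K; first by have [n hn] := h K; exists n.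
    by have [n _ hn] := h K I; exists n.
  apply: bigcapT_measurable => K; apply: bigcupT_measurable => n; exact: measurable_gt_set.
(* The sums from [w] and from [theta 1 w] differ by the term [f w] and a shift of the index. Raising
   the threshold by an integer above [|f w|] absorbs that term. *)
have E1 : theta 1 @^-1` E = E.
  apply/seteqP; split => w /= h K.
    have [n hn] := h (K + (Num.trunc `|f w|).+1)%N; exists n.+1; rewrite SS.
    have := truncnS_gt `|f w|; have := ler_norm (- f w); rewrite normrN.
    by move: hn; rewrite natrD; lra.
  have [[|n] hn] := h (K + (Num.trunc `|f w|).+1)%N.
    by move: hn; rewrite /S big_ord0 ltNge ler0n.
  exists n; have := truncnS_gt `|f w|; have := ler_norm (f w).
  by move: hn; rewrite natrD SS; lra.
have occi := fun w => occupation_integrable mds w mE.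
have pos : 0 <= \int[P]_w (f w * \1_E w).
  apply: (invariant_integral_ge0 (flow_measurable mds 1) (mds_invariant mds 1) fi mE E1).
  move=> w /(_ 0%N) [n hn]; exists n.
  by move: hn; rewrite /S; under eq_bigr do rewrite -iter_flow.
have ione : P.-integrable [set: T] (EFin \o cst (1:R)) by exact: finite_measure_integrable_cst.
have mean1 w : time_one_mean theta (cst 1) w = 1.
  rewrite /time_one_mean Rintegral_cst//= mul1r.
  by have -> := lebesgue_measure_itv `[(0:R), 1]; rewrite /= lte_fin ltr01 /= oppr0 addr0.
(* The Fubini identity for the constant function 1 gives the mean of the occupation time. *)
have occP : \int[P]_w occupation theta E w = fine (P E).
  have := integral_time_one_mean mds ione mE.
  under eq_Rintegral do rewrite mean1 mul1r.
  under [in RHS]eq_Rintegral do rewrite mul1r.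
  by move=> <-; rewrite /Rintegral integral_indic// setIT.
have iocc : P.-integrable [set: T] (EFin \o occupation theta E).
  have := integrable_fubini_F (integrable_backward mds ione mE).
  apply: eq_integrable => // w _; rewrite /fubini_F /= Rintegral_EFin//.
  by apply: eq_integral => s _; rewrite mul1r.
have /integrableP[/measurable_EFinP mocc _] := iocc.
have /integrableP[/measurable_EFinP mr _] := ri.
have occc := invariant_ae_cst mds iocc (occupation_invariant mds mE E1).
have PE : P E = 0%E.
  move: pos; rewrite (integral_time_one_mean mds ri mE).
  have -> : \int[P]_w (r w * occupation theta E w) = \int[P]_w r w * fine (P E).
    rewrite -RintegralZr// -occP; congr fine; apply: ae_eq_integral => //.
    - by apply/measurable_EFinP; exact: measurable_funM.
    - by apply/measurable_EFinP; exact: measurable_funM.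
    - by apply: filterS occc => w -> _.
  rewrite nmulr_rge0// => le0; rewrite -[LHS]fineK ?fin_num_measure//.
  by congr (_%:E); apply/eqP; rewrite eq_le le0 fine_ge0.
apply: filterS (ae_prob0 mE PE) => w /existsNP[K /forallNP hK].
by exists K%:R => n; rewrite leNgt; apply/negP; exact: hK.
Qed.

Lemma sum_flow_drift (r : T -> R) : P.-integrable [set: T] (EFin \o r) ->
  \int[P]_w r w < 0 -> exists2 c : R, 0 < c &
  {ae P, forall w, exists K : R, forall n,
    \sum_(j < n) time_one_mean theta r (theta j%:R w) <= K - c *+ n}.
Proof.
move=> ri r0; pose c := - (\int[P]_w r w) / 2.
have c0 : 0 < c by rewrite /c; lra.
exists c => //.
have ic : P.-integrable [set: T] (EFin \o cst c) by exact: finite_measure_integrable_cst.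
have irc : P.-integrable [set: T] (EFin \o (fun w => r w + c)).
  exact: (integrableD measurableT ri ic).
have rc0 : \int[P]_w (r w + c) < 0.
  rewrite RintegralD// Rintegral_cst// (_ : fine _ = 1); last first.
    exact: (congr1 fine (probability_setT P)).
  rewrite /c; lra.
(* Splitting the mean of [r + c] into that of [r] plus [c] needs [r] integrable on each unit piece
   of the orbit, hence the first event. *)
apply: filterS2 (orbit_integrable_nat ri) (sum_flow_bounded irc rc0).
move=> w iw [K SK]; exists K => n.
rewrite lerBrDr; apply: le_trans (SK n).
rewrite -[X in _ *+ X]card_ord -sumr_const -big_split /=.
apply: ler_sum => j _; rewrite /time_one_mean RintegralD//; last first.
  apply/integrableP; split; first exact: measurable_cst.
  rewrite integral_cst//= ltey_eq fin_numM//.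
  by have -> := lebesgue_measure_itv `[(0:R), 1]; rewrite /= lte_fin ltr01.
  exact: iw.
rewrite Rintegral_cst//.
rewrite [X in _ + c * X](_ : _ = 1) ?mulr1//.
apply: (eq_trans (congr1 fine (lebesgue_measure_itv _))).
by rewrite /= lte_fin ltr01 /= oppr0 addr0.
Qed.

Lemma sum_flow_to_Ny (r : T -> R) : P.-integrable [set: T] (EFin \o r) ->
  \int[P]_w r w < 0 -> forall K : R,
  P [set w | K < \sum_(j < n) time_one_mean theta r (theta j%:R w)]
    @[n --> \oo] --> 0%E.
Proof.
move=> ri r0 K; have [c c0 aeS] := sum_flow_drift ri r0.
apply: prob_cvg0_of_ae_eventually.
  move=> n; apply: measurable_gt_set; apply: measurable_sum => j.
  have /integrableP[/measurable_EFinP mf _] := time_one_mean_integrable mds ri.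
  apply: (measurableT_comp mf); exact: (flow_measurable mds).
apply: filterS aeS => w [L SL].
(* From this index on, [c *+ n] is at least [L - K], so the upper bound on the sum is at most
   [K]. *)
exists (Num.trunc ((L - K) / c)).+1 => // n /= hn; apply/negP; rewrite -leNgt.
apply: le_trans (SL n) _; rewrite lerBlDr -lerBlDl -mulr_natr mulrC -ler_pdivrMr//.
apply: le_trans (ltW (truncnS_gt _)) _; by rewrite ler_nat.
Qed.
End ergodic_sums.

(** * Measurability in separable spaces *)

Lemma measurable_countable_bigcup (d : measure_display) (T : measurableType d)
    (U : Type) (S : set U) (F : U -> set T) : countable S ->
  (forall i, S i -> measurable (F i)) -> measurable (\bigcup_(i in S) F i).
Proof.
move=> /countable_injP[f finj] mF.
have -> : \bigcup_(i in S) F i =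
    \bigcup_n \bigcup_(i in S `&` f @^-1` [set n]) F i.
  apply/seteqP; split => [x [i Si Fi]|x [n _ [i [Si _] Fi]]]; last by exists i.
  by exists (f i) => //; exists i.
apply: bigcupT_measurable => n.
case: (pselect (exists2 i, S i & f i = n)) => [[i Si fi]|nex].
  have -> : S `&` f @^-1` [set n] = [set i].
    apply/seteqP; split => [j [Sj /= fj]|j ->] //.
    by apply: finj; rewrite ?inE// fj.
  by rewrite bigcup_set1; exact: mF.
rewrite [X in \bigcup_(i in X) _](_ : _ = set0) ?bigcup_set0//.
by apply/seteqP; split => // j [Sj /= fj]; case: nex; exists j.
Qed.

Section separable_values.
Context (R : realType) (d : measure_display) (T : measurableType d)
  (H : normedModType R).
Hypothesis sepH : separable H.

Lemma measurable_preimage_open (f : T -> H) (O : set H) :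
  measurable_fun [set: T] (f : T -> borelType H) -> open O -> measurable [set w | O (f w)].
Proof.
move=> mf oO; rewrite -[X in measurable X]setTI.
by apply: mf => //; exact: sub_sigma_algebra.
Qed.

(** By separability, an open set of the product is a countable union of boxes of balls centred in
    the dense set, and each box is a condition on [f] and [g] separately. *)
Lemma measurable_pair_open (f g : T -> H) (O : set (H * H)) :
  measurable_fun [set: T] (f : T -> borelType H) ->
  measurable_fun [set: T] (g : T -> borelType H) ->
  open O -> measurable [set w | O (f w, g w)].
Proof.
move=> mf mg oO; have [S cS dS] := sepH.
have -> : [set w | O (f w, g w)] =
  \bigcup_(n : nat) \bigcup_(a in S) \bigcup_(b in S)
   [set w | (ball a n.+1%:R^-1 `*` ball b n.+1%:R^-1 `<=` O) /\
     (ball a n.+1%:R^-1 (f w) /\ ball b n.+1%:R^-1 (g w))].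
  apply/seteqP; split => [w /= Ow|w [n _ [a Sa [b Sb /= [sub [fa gb]]]]]]; last exact: sub.
  have [e /= e0 eO] : exists2 e : R, 0 < e & ball (f w, g w) e `<=` O.
    by have /nbhs_ballP[e e0 eO] := open_nbhs_nbhs (conj oO Ow); exists e.
  (* Each coordinate of a point of the box is within two radii of [f w] or [g w], hence the half. *)
  have [n ne] : exists n : nat, n.+1%:R^-1 < e / 2.
    exists (Num.trunc (e / 2)^-1).
    by rewrite invf_plt ?posrE ?divr_gt0// truncnS_gt.
  have n0 : (0 : R) < n.+1%:R^-1 by rewrite invr_gt0 ltr0n.
  have [a [fa Sa]] := dS (ball (f w) n.+1%:R^-1)
    (ex_intro _ (f w) (ballxx _ n0)) (ball_open _ _).
  have [b [gb Sb]] := dS (ball (g w) n.+1%:R^-1)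
    (ex_intro _ (g w) (ballxx _ n0)) (ball_open _ _).
  exists n => //; exists a => //; exists b => //=; split; last first.
    by split; exact: ball_sym.
  move=> [x y] [/= ax bY]; apply: eO; split => /=.
    apply: (@le_ball _ _ _ (n.+1%:R^-1 + n.+1%:R^-1)); first by rewrite ltW// (splitr e) ltrD.
    exact: ball_triangle fa ax.
  apply: (@le_ball _ _ _ (n.+1%:R^-1 + n.+1%:R^-1)); first by rewrite ltW// (splitr e) ltrD.
  exact: ball_triangle gb bY.
apply: bigcupT_measurable => n.
have n0 : (0 : R) < n.+1%:R^-1 by rewrite invr_gt0 ltr0n.
apply: measurable_countable_bigcup => // a _.
apply: measurable_countable_bigcup => // b _.
case: (pselect (ball a n.+1%:R^-1 `*` ball b n.+1%:R^-1 `<=` O)) => sub.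
  rewrite (_ : [set w | _] = [set w | ball a n.+1%:R^-1 (f w)] `&`
                             [set w | ball b n.+1%:R^-1 (g w)]).
    by apply: measurableI; apply: measurable_preimage_open => //; exact: ball_open.
  by apply/seteqP; split => w /=; [move=> []|].
rewrite (_ : [set w | _] = set0)//.
by apply/seteqP; split => w //= [].
Qed.

Lemma measurable_le_continuous (f g : T -> H) (q : H -> R) (e : R) :
  measurable_fun [set: T] (f : T -> borelType H) ->
  measurable_fun [set: T] (g : T -> borelType H) ->
  continuous q -> measurable [set w | e <= q (f w - g w)].
Proof.
move=> mf mg cq.
have -> : [set w | e <= q (f w - g w)] =
    ~` [set w | [set z : H * H | q (z.1 - z.2) < e] (f w, g w)].
  by apply/seteqP; split => w /=; rewrite leNgt => /negP.
apply: measurableC; apply: measurable_pair_open => //.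
have -> : [set z : H * H | q (z.1 - z.2) < e] =
  (fun z : H * H => q (z.1 - z.2)) @^-1` [set x | x < e] by [].
apply: open_comp; last exact: open_lt.
move=> z _; apply: (@continuous_comp _ _ _ (fun z : H * H => z.1 - z.2) q); last exact: cq.
exact: sub_continuous.
Qed.

(** As [B w] is closed, membership means that at every scale some point of the dense set is close
    both to [f w] and to [B w]. For empty [B w] the distance is [+oo] and the test fails. *)
Lemma measurable_mem_random_set (B : T -> set H) (f : T -> H) :
  compact_random_set B -> measurable_fun [set: T] (f : T -> borelType H) ->
  measurable [set w | B w (f w)].
Proof.
move=> [cB mB] mf; have [S cS dS] := sepH.
have -> : [set w | B w (f w)] = \bigcap_(n : nat) \bigcup_(a in S)
   ([set w | ball a n.+1%:R^-1 (f w)] `&`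
     [set w | (edist_inf (B w) a <= (n.+1%:R^-1)%:E)%E]).
  apply/seteqP; split => [w /= Bw n _|w /= h].
    have n0 : (0 : R) < n.+1%:R^-1 by rewrite invr_gt0 ltr0n.
    have [a [fa Sa]] := dS (ball (f w) n.+1%:R^-1)
    (ex_intro _ (f w) (ballxx _ n0)) (ball_open _ _).
    have af := ball_sym fa.
    exists a => //; split => //=.
    apply: (@le_trans _ _ (edist (a, f w))); last exact: edist_fin.
    by apply: ereal_inf_lbound; exists (f w).
  have /closure_id -> : closed (B w).
    by apply: compact_closed; [exact: norm_hausdorff|exact: cB].
  move=> U /nbhs_ballP[e /= e0 eU].
  have [n ne] : exists n : nat, n.+1%:R^-1 < e / 3.
    exists (Num.trunc (e / 3)^-1).
    by rewrite invf_plt ?posrE ?divr_gt0// truncnS_gt.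
  have n0 : (0 : R) < n.+1%:R^-1 by rewrite invr_gt0 ltr0n.
  have [a Sa [/= af Ba]] := h n I.
  (* The infimum need not be known to be attained; a strict bound yields a point [b] of [B w] within
     two radii of [a], hence within three of [f w]. *)
  have : (edist_inf (B w) a < (n.+1%:R^-1 + n.+1%:R^-1)%:E)%E.
    by apply: le_lt_trans Ba _; rewrite lte_fin ltrDl.
  move=> /ereal_inf_lt[_ [b Bb <-]] /edist_lt_ball /= ab.
  exists b; split => //; apply: eU.
  apply: le_ball (ball_triangle (ball_sym af) ab).
  by move: (n.+1%:R^-1 : R) ne => x xe; lra.
apply: bigcapT_measurable => n.
apply: measurable_countable_bigcup => // a _; apply: measurableI.
  by apply: measurable_preimage_open => //; exact: ball_open.
rewrite -[X in measurable X]setTI.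
exact: emeasurable_fun_infty_c.
Qed.
End separable_values.

Section sections.
Context (R : realType) (d : measure_display) (T : measurableType d)
  (H : normedModType R) (theta : R -> T -> T) (phi : R -> T -> H -> H).
Hypothesis rds : random_dynamical_system theta phi.

Lemma rds_section_measurable t x : 0 <= t ->
  measurable_fun [set: T] (fun w => phi t w x : borelType H).
Proof.
move=> t0.
have mz : measurable_fun [set: T] (fun w : T => ((t, w), x) : R * T * borelType H).
  by apply: measurable_fun_pair => //; exact: measurable_fun_pair.
apply: (measurable_comp _ _ (rds_measurable rds) mz).
  have -> : [set z : R * T * borelType H | 0 <= z.1.1] =
      (fun z => z.1.1) @^-1` `[0, +oo[%classic.
    by apply/seteqP; split => z /=; rewrite in_itv /= andbT.
  rewrite -[X in measurable X]setTI.
  have m11 : measurable_fun [set: R * T * borelType H] (fun z : R * T * borelType H => z.1.1).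
    exact: (measurableT_comp measurable_fst measurable_fst).
  by apply: m11 => //; exact: measurable_itv.
by move=> z [w _ <-] /=.
Qed.

End sections.

(** * Convergence in probability *)

Lemma cvge0P (R : realType) (I : Type) (F : set_system I) {FF : Filter F} (f : I -> \bar R) :
  (forall i, (0 <= f i)%E) ->
  (f @ F --> 0%E) <-> (forall del : R, 0 < del -> \forall i \near F, (f i <= del%:E)%E).
Proof.
move=> f0; split => [cf del del0|H].
  have : nbhs (0%:E : \bar R) [set x | (x <= del%:E)%E].
    by apply: (filterS _ (open_nbhs_nbhs
      (conj (@open_ereal_lt_ereal R del%:E) _))) => [x /ltW|/=]//; rewrite lte_fin.
  by move/cf.
apply/fine_cvgP; split.
  apply: filterS (H 1 ltr01) => i fi; rewrite ge0_fin_numE//.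
  exact: le_lt_trans fi (ltry _).
apply/cvgrPdist_le => e e0; apply: filterS (H e e0) => i /= fi.
have ffin : f i \is a fin_num by rewrite ge0_fin_numE//; exact: le_lt_trans fi (ltry _).
by rewrite sub0r normrN ger0_norm ?fine_ge0// -lee_fin fineK.
Qed.

Section high_probability.
Context (R : realType) (d : measure_display) (T : measurableType d) (P : probability T R).

(* The exceptional set is measurable, so that [Q] itself need not be. *)
Definition holds_up_to (del : R) (Q : T -> Prop) :=
  exists E, [/\ measurable E, (P E <= del%:E)%E & forall w, ~ E w -> Q w].

Lemma holds_up_toW (del : R) (Q Q' : T -> Prop) : (forall w, Q w -> Q' w) ->
  holds_up_to del Q -> holds_up_to del Q'.
Proof. by move=> QQ' [E [mE PE EQ]]; exists E; split => // w /EQ /QQ'. Qed.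

Lemma holds_up_to_and (a b : R) (Q Q' : T -> Prop) :
  holds_up_to a Q -> holds_up_to b Q' -> holds_up_to (a + b) (fun w => Q w /\ Q' w).
Proof.
move=> [E [mE PE EQ]] [E' [mE' PE' EQ']]; exists (E `|` E'); split.
- exact: measurableU.
- by apply: le_trans (measureU2 _ _ _) _ => //; rewrite EFinD leeD.
- by move=> w /= /not_orP[/EQ ? /EQ'].
Qed.

Lemma holds_up_to_ae (Q : T -> Prop) : {ae P, forall w, Q w} -> holds_up_to 0 Q.
Proof.
move=> [E [mE PE EQ]]; exists E; split; rewrite ?PE// => w nE.
by apply: contrapT => nQ; apply: nE; exact: EQ.
Qed.

Lemma holds_up_to_preimage (U : T -> T) (del : R) (Q : T -> Prop) :
  measurable_fun [set: T] U -> (forall A, measurable A -> P (U @^-1` A) = P A) ->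
  holds_up_to del Q -> holds_up_to del (fun w => Q (U w)).
Proof.
move=> mU pU [E [mE PE EQ]]; exists (U @^-1` E); split.
- by rewrite -[X in measurable X]setTI; exact: mU.
- by rewrite pU.
- by move=> w /EQ.
Qed.

Lemma holds_up_to_set (del : R) (E : set T) : measurable E -> (P E <= del%:E)%E ->
  holds_up_to del (fun w => ~ E w).
Proof. by move=> mE PE; exists E. Qed.

Lemma le_holds_up_to (del : R) (E : set T) : measurable E ->
  holds_up_to del (fun w => ~ E w) -> (P E <= del%:E)%E.
Proof.
move=> mE [F [mF PF FE]]; apply: le_trans PF; apply: le_measure; rewrite ?inE//.
by move=> w Ew; apply: contrapT => /FE.
Qed.

(** Almost every point leaves the events [A n] for large [n], so their probabilities tend to 0. *)
Lemma finite_tight (Z : T -> \bar R) (del : R) : measurable_fun [set: T] Z ->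
  {ae P, forall w, (Z w < +oo)%E} -> 0 < del ->
  exists2 K : R, 0 < K & holds_up_to del (fun w => (Z w <= K%:E)%E).
Proof.
move=> mZ Zoo del0; pose A n := [set w | (n%:R%:E < Z w)%E].
have mA n : measurable (A n).
  by rewrite -[X in measurable X]setTI; exact: emeasurable_fun_o_infty.
have : P (A n) @[n --> \oo] --> 0%E.
  apply: prob_cvg0_of_ae_eventually => //.
  apply: filterS Zoo => w; case Zw: (Z w) => [z| |] // _; last first.
    by apply: nearW => n; rewrite /A /= Zw.
  exists (Num.trunc z).+1 => // n /= zn; rewrite /A /= Zw lte_fin; apply/negP; rewrite -leNgt.
  by apply: le_trans (ltW (truncnS_gt _)) _; rewrite ler_nat.
move/(cvge0P (fun n => measure_ge0 P _)) => /(_ del del0)[n _ /(_ n.+1)/= h].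
exists n.+1%:R; first by rewrite ltr0n.
apply: holds_up_toW (holds_up_to_set (mA n.+1) (h (leqnSn _))) => w /negP.
by rewrite -leNgt.
Qed.

(** This is convergence to 0 in probability, phrased so that sums and products can be handled
    without proving them measurable. *)
Definition tends0 (X : nat -> T -> R) := forall eps del : R, 0 < eps -> 0 < del ->
  \forall n \near \oo, holds_up_to del (fun w => `|X n w| < eps).

Lemma tends0D X Y : tends0 X -> tends0 Y -> tends0 (fun n w => X n w + Y n w).
Proof.
move=> X0 Y0 eps del e0 d0.
have e2 : 0 < eps / 2 by rewrite divr_gt0.
have d2 : 0 < del / 2 by rewrite divr_gt0.
apply: filterS2 (X0 _ _ e2 d2) (Y0 _ _ e2 d2) => n hX hY.
rewrite (splitr del); apply: holds_up_toW (holds_up_to_and hX hY) => w [hx hy].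
by rewrite (splitr eps) (le_lt_trans (ler_normD _ _))// ltrD.
Qed.

Lemma tends0M (Z X : nat -> T -> R) :
  (forall del, 0 < del -> exists2 K : R, 0 < K &
    forall n, holds_up_to del (fun w => `|Z n w| <= K)) ->
  tends0 X -> tends0 (fun n w => Z n w * X n w).
Proof.
move=> tZ X0 eps del e0 d0.
have d2 : 0 < del / 2 by rewrite divr_gt0.
have [K K0 hZ] := tZ _ d2.
have eK : 0 < eps / K by rewrite divr_gt0.
apply: filterS (X0 _ _ eK d2) => n hX.
rewrite (splitr del); apply: holds_up_toW (holds_up_to_and (hZ n) hX) => w [hz hx].
rewrite normrM; apply: (@le_lt_trans _ _ (K * `|X n w|)); first by rewrite ler_wpM2r.
by rewrite mulrC -ltr_pdivlMr.
Qed.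

Lemma tends0_pred X : tends0 X -> tends0 (fun n => X n.-1).
Proof.
move=> X0 eps del e0 d0; have [n0 _ h] := X0 _ _ e0 d0.
exists n0.+1 => // -[|n] //= n0n; exact: h.
Qed.

Lemma cvg0_in_probability_tends0 X :
  (forall n (eps : R), measurable [set w | eps <= `|X n w|]) ->
  cvg0_in_probability P X \oo -> tends0 X.
Proof.
move=> mX cX eps del e0 d0.
have [n0 _ h] := (cvge0P (fun n => measure_ge0 P _)).1 (cX _ e0) del d0.
exists n0 => // n /h /= hn; apply: holds_up_toW (holds_up_to_set (mX n eps) hn) => w /negP.
by rewrite -ltNge.
Qed.

End high_probability.

(** * Iteration of the one-step inequality *)

Section recursion.
Context (R : realType) (d : measure_display) (T : measurableType d)
  (P : probability T R) (theta : R -> T -> T).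
Hypothesis mds : metric_dynamical_system P theta.
Variables (X Y : nat -> T -> R) (f rho : T -> R).
Hypotheses (mf : measurable_fun [set: T] f) (mrho : measurable_fun [set: T] rho).

Lemma holds_up_to_flow t (del : R) (Q : T -> Prop) :
  holds_up_to P del Q -> holds_up_to P del (fun w => Q (theta t w)).
Proof.
exact: (holds_up_to_preimage (flow_measurable mds t) (mds_invariant mds t)).
Qed.

(** These are the [Y] terms left after using the one-step inequality [L] times, backwards from time
    [n]. The truncation of [n.-1] at 0 is harmless, as the pointwise bound is taken at
    [n = m + L]. *)
Fixpoint unrolled (L n : nat) (w : T) : R :=
  if L is L'.+1 then Y n w + expR (f (theta n.-1%:R w)) * unrolled L' n.-1 w
  else 0.

(** By stationarity the coefficients have the same law at all times, so one tightness bound for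
    [expR (f w)] serves every [n]. *)
Lemma unrolled_tends0 L : tends0 P Y -> tends0 P (unrolled L).
Proof.
move=> Y0; elim: L => [|L IH].
  move=> eps del e0 d0; apply: nearW => n; exists set0; split => //.
    by rewrite measure0 lee_fin ltW.
  by move=> w _; rewrite normr0.
apply: tends0D => //.
apply: (@tends0M _ _ _ _ (fun n w => expR (f (theta n.-1%:R w)))
  (fun n => unrolled L n.-1)); last exact: tends0_pred.
move=> del d0.
have mef : measurable_fun [set: T] (fun w => (expR (f w))%:E).
  by apply/measurable_EFinP; exact: measurableT_comp.
have [K K0 hK] := finite_tight mef (aeW P (fun w => ltry _)) d0.
exists K => // n; apply: holds_up_toW (holds_up_to_flow n.-1%:R hK) => w.
by rewrite lee_fin ger0_norm// expR_ge0.
Qed.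

Lemma unrolled_bound L m w :
  (forall n, (m <= n)%N -> X n.+1 w <= Y n.+1 w + expR (f (theta n%:R w)) * X n w) ->
  X (m + L)%N w <= unrolled L (m + L) w +
    expR (\sum_(j < L) f (theta j%:R (theta m%:R w))) * X m w.
Proof.
move=> hX; elim: L => [|L IH].
  by rewrite big_ord0 expR0 mul1r add0r addn0.
rewrite addnS; apply: le_trans (hX _ (leq_addr _ _)) _.
rewrite big_ord_recr /= -(mds_D mds) -natrD [(L + m)%N]addnC expRD -addrA lerD2l.
rewrite mulrC [expR _ * expR _]mulrC -mulrA -mulrDr mulrC.
by rewrite ler_wpM2l// expR_ge0.
Qed.

Lemma recursion_tends0 :
  (forall n w, 0 <= X n w) -> tends0 P Y ->
  (forall K : R, P [set w | K < \sum_(j < n) f (theta j%:R w)] @[n --> \oo] --> 0%E) ->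
  (forall del : R, 0 < del -> exists m,
    holds_up_to P del (fun w => forall n, (m <= n)%N ->
     X n.+1 w <= Y n.+1 w + expR (f (theta n%:R w)) * X n w /\
     X n w <= rho (theta n%:R w))) ->
  tends0 P X.
Proof.
move=> X0 Y0 drift hrec eps del e0 d0.
have d4 : 0 < del / 4 by rewrite divr_gt0.
have e2 : 0 < eps / 2 by rewrite divr_gt0.
have [m hm] := hrec _ d4.
have mErho : measurable_fun [set: T] (EFin \o rho) by exact/measurable_EFinP.
have [K K0 hK] := finite_tight mErho (aeW P (fun w => ltry _)) d4.
(* [L] is chosen after [K]: a sum of at most [ln (eps / 2 / K)] makes the exponential factor times
   [K] at most [eps / 2]. *)
have [L _ /(_ L (leqnn _)) /= hL] :=
  (cvge0P (fun n => measure_ge0 P _)).1 (drift (ln (eps / 2 / K))) _ d4.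
have [n0 _ hn0] := unrolled_tends0 L Y0 e2 d4.
exists (maxn n0 (m + L)) => // n /= /[!geq_max] /andP[n0n mLn].
have [k nk] : exists k, n = (k + L)%N.
  by exists (n - L)%N; rewrite subnK// (leq_trans _ mLn)// leq_addl.
have mk : (m <= k)%N by move: mLn; rewrite nk leq_add2r.
have mE : measurable
    [set w | ln (eps / 2 / K) < \sum_(j < L) f (theta j%:R w)].
  apply: measurable_gt_set; apply: measurable_sum => j.
  by apply: (measurableT_comp mf); exact: (flow_measurable mds).
(* Invariance carries the estimate to the window of length [L] that starts at [k] and ends at [n],
   at no cost in probability. *)
have hS := holds_up_to_flow k%:R (holds_up_to_set mE hL).
have := holds_up_to_and (holds_up_to_and hm (hn0 n n0n))
  (holds_up_to_and (holds_up_to_flow k%:R hK) hS).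
rewrite (_ : del / 4 + del / 4 + (del / 4 + del / 4) = del); last by field.
apply: holds_up_toW => w [[hX hW] [/= hr /negP]]; rewrite -leNgt => hs.
rewrite ger0_norm// nk.
have := @unrolled_bound L k w (fun n kn => (hX n (leq_trans mk kn)).1).
move/le_lt_trans; apply.
rewrite (splitr eps); apply: ltr_leD.
  by apply: le_lt_trans (ler_norm _) _; rewrite -nk.
have eK : 0 < eps / 2 / K by rewrite divr_gt0.
apply: (@le_trans _ _ (eps / 2 / K * K)); last by rewrite divfK// lt0r_neq0.
apply: ler_pM; [exact: expR_ge0|exact: X0| |].
  by rewrite -[leRHS]lnK// ler_expR.
exact: le_trans (hX k mk).2 hr.
Qed.
End recursion.

(** * Entry into the absorbing set, then convergence along integer and real times *)

Theorem theorem2p3 (R : realType) (d : measure_display) (T : measurableType d)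
    (P : probability T R) (theta : R -> T -> T)
    (H : completeNormedModType R) (phi : R -> T -> H -> H)
    (B : T -> set H) (p : R) (M : T -> \bar R) (N : H -> R) (r : T -> R)
    (x1 x2 : H) :
  let rho (w : T) : R := sup [set `|x| | x in B w] in
  metric_dynamical_system P theta ->
  random_dynamical_system theta phi ->
  dissipative_with P theta phi B ->
  tempered P theta (EFin \o rho) ->
  1 <= p ->
  (forall w, Lp_loc p (fun t => rho (theta t w))) ->
  tempered P theta M ->
  {ae P, forall w, (M w < +oo)%E} ->
  (forall w (t : R) (y1 y2 : H), 0 <= t <= 1 -> B w y1 -> B w y2 ->
    (`|phi t w y1 - phi t w y2|%:E <= M w * `|y1 - y2|%:E)%E) ->
  continuous N ->
  (forall x, 0 <= N x) ->
  (exists C : R, forall x, N x <= C * (1 + `|x| `^ p)) ->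
  P.-integrable [set: T] (EFin \o r) ->
  ('E_P[r] < 0)%E ->
  (* the integral in the exponent exists for almost every w *)
  (forall w, lebesgue_measure.-integrable `[0, 1]
                (fun tau : R => (r (theta tau w))%:E) ->
    forall y1 y2 : H, B w y1 -> B w y2 ->
    `|phi 1 w y1 - phi 1 w y2| <=
      N (phi 1 w y1 - phi 1 w y2) +
      expR (\int[lebesgue_measure]_(tau in `[0, 1]) r (theta tau w)) *
        `|y1 - y2|) ->
  cvg0_in_probability P (fun (n : nat) w => N (phi n%:R w x1 - phi n%:R w x2))
    \oo ->
  cvg0_in_probability P (fun (t : R) w => `|phi t w x1 - phi t w x2|) +oo.
Proof.
move=> rho mds rds diss trho _ _ tM Mfin lipM cN N0 _ ri r0 sq Nto0.
have sepH := rds_separable rds.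
have mphi t x (t0 : 0 <= t) := rds_section_measurable rds x t0.
have [cB mB] := dissipative_set diss.
have mrho : measurable_fun [set: T] rho.
  by have /measurable_EFinP := tempered_measurable trho.
(* A real [sup] is an upper bound only for a set bounded above; compactness of [B w] provides
   this. *)
have rhoE w y : B w y -> `|y| <= rho w.
  move=> By; apply: ub_le_sup; last by exists y.
  have /compact_bounded[K [_ hK]] := cB w.
  by exists (K + 1) => _ [z Bz <-]; apply: hK => //; rewrite ltrDl.
pose X (t : R) w := `|phi t w x1 - phi t w x2|.
pose Y (n : nat) w := N (phi n%:R w x1 - phi n%:R w x2).
have Y0 : tends0 P Y.
  apply: cvg0_in_probability_tends0 => // n eps.
  have -> : [set w | eps <= `|Y n w|] =
      [set w | eps <= N (phi n%:R w x1 - phi n%:R w x2)].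
    by apply/seteqP; split => w /=; rewrite ger0_norm ?N0.
  by apply: measurable_le_continuous => //; apply: mphi.
have Er : \int[P]_w r w < 0.
  rewrite -lte_fin Rintegral_EFin//; move: r0; rewrite unlock; exact.
pose f := time_one_mean theta r.
have mf : measurable_fun [set: T] f.
  by have /integrableP[/measurable_EFinP] := time_one_mean_integrable mds ri.
pose inB (n : nat) w :=
  B (theta n%:R w) (phi n%:R w x1) /\ B (theta n%:R w) (phi n%:R w x2).
have mBtheta t : compact_random_set (fun w => B (theta t w)).
  split=> [w|x]; first exact: cB.
  by apply: (measurableT_comp (mB x)); exact: (flow_measurable mds).
have absorb (x : H) del : 0 < del -> exists m, forall n, (m <= n)%N ->
    holds_up_to P del (fun w => B (theta n%:R w) (phi n%:R w x)).
  move=> d0; have mc : measurable_fun [set: T] ((fun=> x) : T -> borelType H).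
    exact: measurable_cst.
  have [t0 t00 ht] := dissipative_absorbing diss d0 mc.
  exists (Num.trunc t0).+1 => n mn.
  have t0n : t0 <= n%:R by rewrite (le_trans (ltW (truncnS_gt t0)))// ler_nat.
  have mE : measurable [set w | B (theta n%:R w) (phi n%:R w x)].
    by apply: (measurable_mem_random_set sepH (mBtheta n%:R)); apply: mphi.
  exists (~` [set w | B (theta n%:R w) (phi n%:R w x)]); split.
  - exact: measurableC.
  - rewrite probability_setC//; move: (ht _ t0n).
    by rewrite -(fineK (fin_num_measure P _ mE)) -EFinB !lee_fin; lra.
  - by move=> w /contrapT.
have stay n m w : (m <= n)%N -> inB m w -> inB n w.
  rewrite leq_eqVlt => /predU1P[->//|mn] [h1 h2].
  have nm : 0 < (n - m)%:R :> R by rewrite ltr0n subn_gt0.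
  have nE : n%:R = (n - m)%:R + m%:R :> R by rewrite -natrD subnK// ltnW.
  rewrite /inB nE (mds_D mds) !(rds_D rds)// ?ltW//.
  by split; apply: (dissipative_invariant diss nm);
    [exists (phi m%:R w x1)|exists (phi m%:R w x2)].
(* By forward invariance, a single exceptional event at time [m] serves all later integer times. *)
have hinB del : 0 < del -> exists m,
    holds_up_to P del (fun w => forall n, (m <= n)%N -> inB n w).
  move=> d0; have d2 : 0 < del / 2 by rewrite divr_gt0.
  have [m1 h1] := absorb x1 _ d2; have [m2 h2] := absorb x2 _ d2.
  exists (maxn m1 m2); rewrite (splitr del).
  have := holds_up_to_and (h1 _ (leq_maxl m1 m2)) (h2 _ (leq_maxr m1 m2)).
  apply: holds_up_toW => w hw n mn.
  exact: stay mn hw.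
have Xto0 : tends0 P (fun n => X n%:R).
  (* The stationary bound on the distance is [rho + rho], by the triangle inequality in [B]. *)
  apply: (recursion_tends0 mds mf (measurable_funD mrho mrho) _ Y0) => //.
    by move=> n w; exact: normr_ge0.
    exact: (sum_flow_to_Ny mds ri Er).
  move=> del d0; have [m hm] := hinB _ d0; exists m.
  (* Almost surely the exponent exists at all integer times at once, so the one-step inequality is
     available at no cost in probability. *)
  have aei := holds_up_to_ae (orbit_integrable_nat mds ri).
  rewrite -[del]addr0.
  apply: holds_up_toW (holds_up_to_and hm aei) => w [hw iw] n mn.
  have [b1 b2] := hw n mn; split; last first.
    by rewrite (le_trans (ler_normB _ _))// lerD// rhoE.
  have := sq _ (iw n) _ _ b1 b2.
  by rewrite -!(rds_D rds)// -[1 + n%:R]addrC natr1.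
have mX t eps : 0 <= t -> measurable [set w | eps <= `| X t w| ].
  move=> t0; have -> : [set w | eps <= `|X t w|] =
      [set w | eps <= `|phi t w x1 - phi t w x2| ].
    by apply/seteqP; split => w /=; rewrite normr_id.
  apply: (@measurable_le_continuous _ _ _ _ sepH _ _ (fun x : H => `|x|)) => //;
    [exact: mphi|exact: mphi|exact: norm_continuous].
move=> eps e0.
apply/(cvge0P (fun t => measure_ge0 P _)) => del d0.
have d3 : 0 < del / 3 by rewrite divr_gt0.
have [K K0 hK] := finite_tight (tempered_measurable tM) Mfin d3.
have [m hm] := hinB _ d3.
(* At integer times the distance must be below [eps / K], because it may grow by the factor [K]
   before the next one. *)
have [n0 _ hn0] := Xto0 _ _ (divr_gt0 e0 K0) d3.
exists (maxn m n0)%:R; split; first exact: num_real.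
move=> t /ltW mt.
have t0 : 0 <= t by apply: le_trans mt.
apply: le_holds_up_to; first exact: mX.
pose n := Num.trunc t.
have nt : n%:R <= t by rewrite truncn_le.
have tn1 : t < n.+1%:R := truncnS_gt t.
have mn : (maxn m n0 <= n)%N by rewrite -ltnS -(ltr_nat R) (le_lt_trans mt).
move: mn; rewrite geq_max => /andP[mn n0n].
have := holds_up_to_and
  (holds_up_to_and (holds_up_to_flow mds n%:R hK) hm) (hn0 n n0n).
rewrite (_ : del / 3 + del / 3 + del / 3 = del); last by field.
apply: holds_up_toW => w [[/= hMK /(_ n mn)[b1 b2]]].
rewrite /X normr_id => hX /=; apply/negP; rewrite normr_id -ltNge.
have tE : t = (t - n%:R) + n%:R by rewrite subrK.
have s0 : 0 <= t - n%:R by rewrite subr_ge0.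
(* The Lipschitz estimate is used at [theta n%:R w] over the remaining time [t - n%:R]; the cocycle
   property then gives the states at time [t]. *)
have s01 : 0 <= t - n%:R <= 1 by rewrite s0 lerBlDr addrC natr1 ltW.
have := lipM _ _ _ _ s01 b1 b2; rewrite -!(rds_D rds)// -tE => hle.
have : (`|phi t w x1 - phi t w x2|%:E <= K%:E * (X n%:R w)%:E)%E.
  by apply: le_trans hle _; rewrite lee_wpmul2r ?lee_fin.
rewrite -EFinM lee_fin => /le_lt_trans; apply.
by rewrite mulrC -ltr_pdivlMr.
Qed.
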